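(* Let $\mathcal{H}$ be a real Hilbert space, let $u_1,u_2\in\mathcal{H}$ be linearly independent, let $\eta_1,\eta_2\in\mathbb{R}$, and set $H_1:=\{x\in\mathcal{H}:\langle x,u_1\rangle=\eta_1\}$, $W_2:=\{x\in\mathcal{H}:\langle x,u_2\rangle\le\eta_2\}$ and $H_2:=\{x\in\mathcal{H}:\langle x,u_2\rangle=\eta_2\}$. Let $x\in\mathcal{H}$. Then $H_1\cap W_2\neq\varnothing$ and $$P_{H_1\cap W_2}x=x-\xi_1u_1-\xi_2u_2,$$ where exactly one of the following holds: (i) $(\langle x,u_2\rangle-\eta_2)\|u_1\|^2-(\langle x,u_1\rangle-\eta_1)\langle u_1,u_2\rangle>0$. Then $$\xi_1=\frac{(\langle x,u_1\rangle-\eta_1)\|u_2\|^2-(\langle x,u_2\rangle-\eta_2)\langle u_1,u_2\rangle}{\|u_1\|^2\|u_2\|^2-|\langle u_1,u_2\rangle|^2},\qquad \xi_2=\frac{(\langle x,u_2\rangle-\eta_2)\|u_1\|^2-(\langle x,u_1\rangle-\eta_1)\langle u_1,u_2\rangle}{\|u_1\|^2\|u_2\|^2-|\langle u_1,u_2\rangle|^2}>0.$$ Moreover, $P_{H_1\cap W_2}x=P_{H_1\cap H_2}x$. (ii) $(\langle x,u_2\rangle-\eta_2)\|u_1\|^2-(\langle x,u_1\rangle-\eta_1)\langle u_1,u_2\rangle\le0$. Then $\xi_1=\frac{\langle x,u_1\rangle-\eta_1}{\|u_1\|^2}$ and $\xi_2=0$. Moreover, $P_{H_1\cap W_2}x=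P_{H_1}x$.
   Context: For a nonempty closed convex set $C\subseteq\mathcal{H}$, $P_C$ maps each point of $\mathcal{H}$ to its unique nearest point in $C$. *)

(* Defs.v *)
From HB Require Import structures.
From mathcomp Require Import all_boot all_order all_algebra.
From mathcomp Require Import all_classical all_reals all_analysis.
From mathcomp Require Import ring lra.

Set Implicit Arguments.
Unset Strict Implicit.
Unset Printing Implicit Defensive.

Import Order.TTheory GRing.Theory Num.Theory.
Import numFieldNormedType.Exports.

Local Open Scope classical_set_scope.
Local Open Scope ring_scope.

(* A real Hilbert space is rendered as a complete normed module over the reals
   together with a symmetric positive definite bilinear form (the library's
   [{dot H for idfun}]) that induces the norm. *)
Definition induces_norm (R : realType) (H : normedModType R)
    (dot : {dot H for idfun}) : Prop :=
  forall z : H, `|z| = Num.sqrt (dot z z).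

(* [free] is only available in finite dimension ([vectType]). *)
Definition lin_indep2 (R : realType) (H : lmodType R) (u v : H) : Prop :=
  forall a b : R, a *: u + b *: v = 0 -> a = 0 /\ b = 0.

Definition nearest (R : realType) (H : normedModType R)
    (C : set H) (x : H) : set H :=
  [set p | C p /\ forall y, C y -> `|x - p| <= `|x - y|].

(* [metric_proj C x] is the unique nearest point to [x] in [C]; the default
   value [x] is taken only when there is no such point, which
   [nearest_metric_proj] excludes for nonempty closed convex sets of a Hilbert
   space. *)
Definition metric_proj (R : realType) (H : normedModType R)
    (C : set H) (x : H) : H :=
  xget x [set p | nearest C x = [set p]].

Lemma sqr_norm_dot (R : realType) (H : normedModType R)
    (dot : {dot H for idfun}) (dotE : induces_norm dot) (z : H) :
  `|z| ^+ 2 = dot z z.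
Proof.
rewrite dotE sqr_sqrtr//; have [->|z0] := eqVneq z 0.
  by rewrite linear0l.
exact/ltW/neq0_dnorm_gt0.
Qed.

Lemma parallelogram (R : realType) (H : normedModType R)
    (dot : {dot H for idfun}) (dotE : induces_norm dot) (a b : H) :
  `|a + b| ^+ 2 + `|a - b| ^+ 2 = 2 * `|a| ^+ 2 + 2 * `|b| ^+ 2.
Proof.
rewrite !(sqr_norm_dot dotE) (hnormD (theta := idfun)) (hnormB (theta := idfun)) /=.
by ring.
Qed.

Lemma nearest_metric_proj (R : realType) (H : completeNormedModType R)
    (dot : {dot H for idfun}) (dotE : induces_norm dot)
    (C : set H) (x : H) :
  C !=set0 -> closed C -> convex_set C -> nearest C x = [set metric_proj C x].
Proof.
move=> C0 Ccl Ccv.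
pose E := [set `|x - y| ^+ 2 | y in C].
pose d := inf E.
have Einf : has_inf E.
  split; first by case: C0 => y Cy; exists (`|x - y| ^+ 2); exists y.
  by exists 0 => _ [y Cy <-]; exact: sqr_ge0.
have dle y : C y -> d <= `|x - y| ^+ 2.
  by move=> Cy; apply: ge_inf; [exact: Einf.2|exists y].
have gap y z : C y -> C z ->
    `|y - z| ^+ 2 <= 2 * `|x - y| ^+ 2 + 2 * `|x - z| ^+ 2 - 4 * d.
  move=> Cy Cz.
  have Cm : C (2^-1 *: (y + z)).
    have h0 : (0 : R) < 2^-1 by rewrite invr_gt0.
    have h1 : (2^-1 : R) < 1 by lra.
    have := Ccv y z (Itv01 (ltW h0) (ltW h1)).
    rewrite !inE => /(_ Cy Cz); rewrite /conv/=.
    rewrite scalerDr /unstable.onem.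
    by have -> : 1 - 2^-1 = 2^-1 :> R by field.
  have := parallelogram dotE (x - y) (x - z).
  have -> : (x - y) + (x - z) = 2 *: (x - 2^-1 *: (y + z)).
    rewrite scalerBr scalerA divff ?pnatr_eq0// scale1r scaler_nat mulr2n.
    by rewrite addrACA opprD.
  have -> : (x - y) - (x - z) = - (y - z).
    by rewrite opprB addrC subrKA opprB.
  rewrite normrN normrZ ger0_norm// exprMn.
  by have := dle _ Cm; lra.
pose B (e : R) := [set y | C y /\ `|x - y| ^+ 2 < d + e].
pose F := filter_from [set e : R | 0 < e] B.
have FF : ProperFilter F.
  apply: filter_from_proper; last first.
    move=> e /= e0; have [_ [y Cy <-] lt] := inf_adherent e0 Einf.
    by exists y; split.
  apply: filter_from_filter; first by exists 1; exact: ltr01.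
  move=> i j /= i0 j0; exists (Num.min i j); first by rewrite /= lt_min i0.
  move=> y [Cy yl]; split; split=> //; apply: (lt_le_trans yl);
    by rewrite lerD2l ge_min lexx ?orbT.
have Fcvg : cvg F.
  apply: cauchy_cvg; apply/cauchy_ballP => e e0.
  pose k := e ^+ 2 / 4.
  have k0 : 0 < k by rewrite divr_gt0// exprn_gt0.
  exists (B k, B k) => /=; first by split; exists k.
  move=> [y z] /= [[Cy ly] [Cz lz]].
  rewrite -ball_normE/= -(@ltr_pXn2r _ 2)// ?nnegrE ?(ltW e0)//.
  have := gap _ _ Cy Cz; have : 4 * k = e ^+ 2 by rewrite /k; field.
  by lra.
have [p Fp] := (cvg_ex _).1 Fcvg.
have Cp : C p.
  apply: (@closed_cvg _ _ F FF id C Ccl) => //.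
  by exists 1 => [/=|y []//]; exact: ltr01.
have pd : `|x - p| ^+ 2 <= d.
  apply/ler_addgt0Pr => e e0.
  have cv : (fun y => `|x - y| ^+ 2) @ F --> `|x - p| ^+ 2.
    by apply: cvgM; apply: cvg_norm; apply: cvgB => //; exact: cvg_cst.
  apply: (@closed_cvg _ _ F FF _ _ (@closed_le R (d + e)) _ _ cv).
  by exists e => // y [_ /ltW].
have sqle a b : `|a : H| <= `|b : H| <-> `|a| ^+ 2 <= `|b| ^+ 2.
  by rewrite ler_pXn2r// nnegrE.
have near : nearest C x = [set p].
  apply/seteqP; split=> [q [Cq qm]|_ ->] /=; last first.
    by split=> // y Cy; apply/sqle; exact: (le_trans pd (dle _ Cy)).
  have := gap _ _ Cq Cp; have /sqle := qm _ Cp => qp h.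
  have : `|q - p| ^+ 2 <= 0 by lra.
  by rewrite real_exprn_even_le0// ?num_real// normr_eq0 subr_eq0 => /eqP.
by rewrite /metric_proj; case: xgetP => [q _ /= -> //|/(_ p)].
Qed.

(* Main.v *)
Require Import Defs.
From HB Require Import structures.
From mathcomp Require Import all_boot all_order all_algebra.
From mathcomp Require Import all_classical all_reals all_analysis.
From mathcomp Require Import ring lra.

Set Implicit Arguments.
Unset Strict Implicit.
Unset Printing Implicit Defensive.

Import Order.TTheory GRing.Theory Num.Theory.
Import numFieldNormedType.Exports.

Local Open Scope classical_set_scope.
Local Open Scope ring_scope.

(** The residual [x - p] of the claimed projection is a combination
    [xi1 *: u1 + xi2 *: u2] of the normals, and such a [p] is the nearest point
    as soon as it satisfies the Kuhn-Tucker conditions: [p] is feasible, the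
    multiplier [xi1] of the equality is free, and [xi2] is nonnegative and
    vanishes unless the inequality is active at [p].  Indeed these conditions
    make [dot (x - p) (y - p)] nonpositive for each feasible [y]
    ([dot_residual]), and such an obtuse angle forces [p] to be the unique
    nearest point ([metric_proj_obtuse]).

    The two cases are the two ways to meet the complementarity condition.
    The number whose sign is tested is [`|u1| ^+ 2] times the amount by which
    the projection of [x] onto the hyperplane [H1] violates the inequality.  If
    it is nonpositive, that projection is feasible and [xi2 = 0] works.
    Otherwise the inequality is active; requiring both equalities gives a 2x2
    linear system in [xi1, xi2], whose determinant, the Gram determinant of
    [u1, u2], is positive by linear independence ([gram_gt0]).  Cramer's rule
    gives the stated formulas, with [xi2] of the sign of the tested number.
    For the comparison with the other projection: in the first case [p] lies on
    both hyperplanes, in the second [xi2 = 0] makes the residual orthogonal to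
    the directions of [H1], so the obtuse angle condition holds on that other set too. *)

Section Projection.
Variables (R : realType) (H : normedModType R) (dot : {dot H for idfun}).
Hypothesis dotE : induces_norm dot.

Lemma dot_sym (a b : H) : dot a b = dot b a.
Proof. by rewrite (hermC dot) /= expr0 mul1r. Qed.

Lemma metric_proj_nearest (C : set H) (x p : H) :
  nearest C x = [set p] -> metric_proj C x = p.
Proof.
move=> near; rewrite /metric_proj; case: xgetP => [q _ /= qnear|/(_ p)//].
by have : [set p] q by rewrite -near qnear.
Qed.

(** Expanding [`|x - y| ^+ 2] around [p] gives
    [`|x - p| ^+ 2 + `|y - p| ^+ 2 - 2 * dot (x - p) (y - p)], so the obtuse
    angle makes [p] at least as close as [y], with equality only at [y = p]. *)
Lemma metric_proj_obtuse (C : set H) (x p : H) :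
  C p -> (forall y, C y -> dot (x - p) (y - p) <= 0) -> metric_proj C x = p.
Proof.
move=> Cp obtuse; apply: metric_proj_nearest.
have gap y : C y -> `|x - p| ^+ 2 + `|y - p| ^+ 2 <= `|x - y| ^+ 2.
  move=> /obtuse; have -> : x - y = (x - p) - (y - p).
    by rewrite opprB addrC subrKA addrC.
  move: (x - p) (y - p) => r s rs; rewrite !(sqr_norm_dot dotE).
  by rewrite (hnormB (theta := idfun)) /= expr0 mul1r; lra.
have sqle (a b : H) : (`|a| <= `|b|) = (`|a| ^+ 2 <= `|b| ^+ 2).
  by rewrite ler_pXn2r// nnegrE.
apply/seteqP; split=> [q [Cq qmin]|_ ->] /=; last first.
  by split=> // y Cy; rewrite sqle; have := gap y Cy; have := sqr_ge0 `|y - p|; lra.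
have := qmin p Cp; rewrite sqle => qp; have := gap q Cq => pq.
have : `|q - p| ^+ 2 <= 0 by lra.
by rewrite real_exprn_even_le0// ?num_real// normr_eq0 subr_eq0 => /eqP.
Qed.

Variables u1 u2 : H.

Lemma dot_combination (x z : H) (a b : R) :
  dot (x - a *: u1 - b *: u2) z = dot x z - a * dot u1 z - b * dot u2 z.
Proof. by rewrite !linearBl !linearZl_LR. Qed.

(** The Kuhn-Tucker grouping: for feasible [y], the first bracket is zero, and
    the second is zero or nonpositive as soon as the corresponding constraint is
    active at [p]. *)
Lemma dot_residual (x y : H) (a b : R) (p := x - a *: u1 - b *: u2) :
  dot (x - p) (y - p) =
  a * (dot y u1 - dot p u1) + b * (dot y u2 - dot p u2).
Proof.
have -> : x - p = a *: u1 + b *: u2 by rewrite /p -addrA -opprD subKr.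
by rewrite linearDl !linearZl_LR /= !(dot_sym _ (y - p)) !linearBl.
Qed.

Hypothesis hu : lin_indep2 u1 u2.

Lemma dot_self_gt0 (z : H) : z != 0 -> 0 < dot z z.
Proof. exact: neq0_dnorm_gt0. Qed.

Lemma lin_indep2_dot_gt0 : 0 < dot u1 u1.
Proof.
apply: dot_self_gt0; apply/eqP => u10.
have [] := hu (a := 1) (b := 0); first by rewrite u10 scaler0 scale0r addr0.
by move/eqP; rewrite oner_eq0.
Qed.

(** The vector [dot u1 u1 *: u2 - dot u1 u2 *: u1], a multiple of the component
    of [u2] orthogonal to [u1], is nonzero and its squared norm is [dot u1 u1]
    times the Gram determinant. *)
Lemma gram_gt0 : 0 < dot u1 u1 * dot u2 u2 - dot u1 u2 ^+ 2.
Proof.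
have u1_gt0 := lin_indep2_dot_gt0.
(* The leading 0 and the signs match the shape of dot_combination. *)
pose v := 0 - dot u1 u2 *: u1 - (- dot u1 u1) *: u2.
have v_neq0 : v != 0.
  apply/eqP; rewrite /v sub0r -!scaleNr opprK => /hu[_ u1_eq0].
  by move: u1_gt0; rewrite u1_eq0 ltxx.
rewrite -(pmulr_rgt0 _ u1_gt0).
suff -> : dot u1 u1 * (dot u1 u1 * dot u2 u2 - dot u1 u2 ^+ 2) = dot v v.
  exact: dot_self_gt0.
rewrite {1}/v dot_combination !(dot_sym _ v) /v !dot_combination !linear0l.
by rewrite (dot_sym u2 u1); ring.
Qed.

End Projection.

Theorem theorem5p6 (R : realType) (H : completeNormedModType R)
    (dot : {dot H for idfun}) (dotE : induces_norm dot)
    (u1 u2 : H) (hu : lin_indep2 u1 u2) (eta1 eta2 : R) (x : H) :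
  let H1 : set H := [set z | dot z u1 = eta1] in
  let W2 : set H := [set z | dot z u2 <= eta2] in
  let H2 : set H := [set z | dot z u2 = eta2] in
  let case_i : Prop :=
    (dot x u2 - eta2) * `|u1| ^+ 2 - (dot x u1 - eta1) * dot u1 u2 > 0 in
  let case_ii : Prop :=
    (dot x u2 - eta2) * `|u1| ^+ 2 - (dot x u1 - eta1) * dot u1 u2 <= 0 in
  (H1 `&` W2) !=set0 /\
  exists xi1 xi2 : R,
    [/\ metric_proj (H1 `&` W2) x = x - xi1 *: u1 - xi2 *: u2,
        (case_i /\ ~ case_ii) \/ (~ case_i /\ case_ii),
        case_i ->
          [/\ xi1 = ((dot x u1 - eta1) * `|u2| ^+ 2
                       - (dot x u2 - eta2) * dot u1 u2)
                    / (`|u1| ^+ 2 * `|u2| ^+ 2 - `|dot u1 u2| ^+ 2),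
              xi2 = ((dot x u2 - eta2) * `|u1| ^+ 2
                       - (dot x u1 - eta1) * dot u1 u2)
                    / (`|u1| ^+ 2 * `|u2| ^+ 2 - `|dot u1 u2| ^+ 2),
              xi2 > 0
            & metric_proj (H1 `&` W2) x = metric_proj (H1 `&` H2) x]
      & case_ii ->
          [/\ xi1 = (dot x u1 - eta1) / `|u1| ^+ 2,
              xi2 = 0
            & metric_proj (H1 `&` W2) x = metric_proj H1 x]].
Proof.
move=> H1 W2 H2 case_i case_ii.
rewrite /case_i /case_ii real_normK ?num_real// !(sqr_norm_dot dotE).
have u1_gt0 := lin_indep2_dot_gt0 dot hu; have g_gt0 := gram_gt0 dot hu.
have [gt0|le0] := ltP 0 ((dot x u2 - eta2) * dot u1 u1
                         - (dot x u1 - eta1) * dot u1 u2).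
- pose g := dot u1 u1 * dot u2 u2 - dot u1 u2 ^+ 2.
  pose a := ((dot x u1 - eta1) * dot u2 u2 - (dot x u2 - eta2) * dot u1 u2) / g.
  pose b := ((dot x u2 - eta2) * dot u1 u1 - (dot x u1 - eta1) * dot u1 u2) / g.
  have b_gt0 : 0 < b by rewrite divr_gt0.
  pose p := x - a *: u1 - b *: u2.
  have g_neq0 : dot u1 u1 * dot u2 u2 - dot u1 u2 ^+ 2 != 0 by rewrite gt_eqF.
  have pH1 : dot p u1 = eta1.
    by rewrite /p dot_combination (dot_sym dot u2 u1) /a /b /g; field.
  have pH2 : dot p u2 = eta2 by rewrite /p dot_combination /a /b /g; field.
  have pW2 : dot p u2 <= eta2 by rewrite pH2.
  have projW : metric_proj (H1 `&` W2) x = p.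
    apply: (metric_proj_obtuse dotE) => // y [yH1 yW2].
    rewrite dot_residual -/p pH1 pH2 yH1 subrr mulr0 add0r.
    by rewrite pmulr_rle0// subr_le0.
  have projH : metric_proj (H1 `&` H2) x = p.
    apply: (metric_proj_obtuse dotE) => // y [yH1 yH2].
    by rewrite dot_residual -/p pH1 pH2 yH1 yH2 !subrr !mulr0 addr0.
  split; first by exists p.
  exists a, b; split=> //; first by left.
  by rewrite projW projH.
- pose a := (dot x u1 - eta1) / dot u1 u1.
  pose p := x - a *: u1 - 0 *: u2.
  have u1_neq0 : dot u1 u1 != 0 by rewrite gt_eqF.
  have pH1 : dot p u1 = eta1.
    by rewrite /p dot_combination /a; field.
  (* Scaled by dot u1 u1, the violation of the inequality at p is exactly the
     tested number. *)
  have pW2 : dot p u2 <= eta2.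
    rewrite -subr_le0 -(pmulr_rle0 _ u1_gt0) /p dot_combination.
    by move: le0; congr (_ <= 0); rewrite /a; field.
  have proj (C : set H) : C `<=` H1 -> C p -> metric_proj C x = p.
    move=> CH1 Cp; apply: (metric_proj_obtuse dotE) => // y /CH1 yH1.
    by rewrite dot_residual -/p pH1 yH1 subrr mulr0 mul0r addr0.
  have projW : metric_proj (H1 `&` W2) x = p by apply: proj => // y [].
  split; first by exists p.
  exists a, 0; split=> //; first by right; split=> //; rewrite ltNge le0.
  by move=> _; rewrite projW (proj H1).
Qed.
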